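(* For $n\ge 2$ let $\Gamma=\mathrm{SL}_n(\mathbb{Z})$ in $\mathrm{SL}_n(\mathbb{R})$, let $\Sigma=\Sigma_{\frac{2}{\sqrt3},\frac12}\subset\mathrm{SL}_n(\mathbb{R})$ be the Siegel set with parameters $t=\frac{2}{\sqrt3}$ and $\lambda=\frac12$, and let $\mathcal{I}=\{\gamma\in\Gamma:\ \gamma\Sigma\cap\Sigma\neq\emptyset\}$. There exist constants $c_1,c_2>0$, not depending on $n$, such that $$e^{c_1n^3}\le|\mathcal{I}|\le e^{c_2n^4\ln(n)}.$$
   Context: Let $K=\mathrm{SO}_n$, let $A$ be the group of diagonal matrices $a=\mathrm{diag}(a_1,\dots,a_n)$ with all $a_i>0$ and $\prod_{i=1}^n a_i=1$, and let $N$ be the group of upper triangular real $n\times n$ matrices with all diagonal entries equal to $1$. The group $\Gamma$ acts on $\mathrm{SL}_n(\mathbb{R})$ by left translations. Siegel sets: for $t,\lambda>0$, let $A_t=\{a\in A:\ a_i/a_{i+1}\le t\text{ for } i=1,\dots,n-1\}$, $N_\lambda=\{u\in N:\ |u_{ij}|\le\lambda\text{ for all } 1\le i<j\le n\}$, and $\Sigma_{t,\lambda}=A_tN_\lambda K\subset\mathrm{SL}_n(\mathbb{R})$.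
   Formalization: The Siegel set is taken as N_λ A_t^{-1} K instead of A_t N_λ K: with the printed product and left translations, every matrix (1 0; k 1) in SL_2(Z) lies in I, so I is infinite and the upper bound fails. *)

(* Defs.v *)
From HB Require Import structures.
From mathcomp Require Import all_boot all_order all_algebra.
From mathcomp Require Import all_classical all_reals all_analysis.
Set Implicit Arguments.
Unset Strict Implicit.
Unset Printing Implicit Defensive.
Import Order.TTheory GRing.Theory Num.Theory.
Local Open Scope classical_set_scope.
Local Open Scope ring_scope.

Section Siegel.
Variables (R : realType) (n : nat).

Definition SO_set : set 'M[R]_n :=
  [set k | k *m k^T = 1%:M /\ \det k = 1].

Definition A_set : set 'M[R]_n :=
  [set diag_mx d | d in
     [set d : 'rV[R]_n | (forall i, 0 < d ord0 i) /\ \prod_i d ord0 i = 1]].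

Definition N_set : set 'M[R]_n :=
  [set u | (forall i, u i i = 1) /\ (forall i j : 'I_n, (j < i)%N -> u i j = 0)].

Definition A_t (t : R) : set 'M[R]_n :=
  [set a | A_set a /\
     forall i j : 'I_n, nat_of_ord j = i.+1 -> a i i / a j j <= t].

Definition N_lambda (lambda : R) : set 'M[R]_n :=
  [set u | N_set u /\ forall i j : 'I_n, (i < j)%N -> `|u i j| <= lambda].

(* The order of the factors and the exponent of the A-part are tied to the
   side on which the arithmetic group acts.  Gamma acts here on the left, so
   the Siegel set is N_lambda A_t^-1 K.  Transposing, and conjugating by the
   permutation matrix of i |-> n + 1 - i (which preserves SL_n(Z) and K, maps
   N_lambda^T to N_lambda and A_t to A_t^-1), turns it into Borel's K A_t N_lambda
   with Gamma acting on the right, and I into a set of the same cardinality.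
   The product A_t N_lambda K would not do for a left action: its translates
   by the matrices (1 0; k 1) of SL_2(Z) meet it for every integer k. *)
Definition Siegel_set (t lambda : R) : set 'M[R]_n :=
  [set g | exists u a k, [/\ N_lambda lambda u, A_t t a, SO_set k &
                             g = u *m invmx a *m k]].

Definition SLZ : set 'M[R]_n :=
  [set map_mx (fun z : int => z%:~R) g | g in [set g : 'M[int]_n | \det g = 1]].

Definition left_translate (gamma : 'M[R]_n) (S : set 'M[R]_n) : set 'M[R]_n :=
  [set gamma *m g | g in S].

Definition self_meeting (Gamma S : set 'M[R]_n) : set 'M[R]_n :=
  [set gamma | Gamma gamma /\ left_translate gamma S `&` S !=set0].

End Siegel.

Arguments SO_set R n : clear implicits.
Arguments A_set R n : clear implicits.
Arguments N_set R n : clear implicits.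
Arguments A_t {R} n t.
Arguments N_lambda {R} n lambda.
Arguments Siegel_set {R} n t lambda.
Arguments SLZ R n : clear implicits.

(* Main.v *)
(* Write a point of the Siegel set as u b k with b = a^-1 diagonal; then
   gamma meets the Siegel set with itself when gamma u b = u' b' kappa for two
   such pairs (u, b), (u', b') and an orthogonal kappa.

   Upper bound.  Integrality of gamma and of its inverse gives
   b_q <= n^O(n) b'_p whenever gamma_pq <> 0, and b'_i <= n^O(n) b_i for all i.
   Hence, where the sequence b drops by more than a factor n^O(n), gamma is
   block triangular, so kappa is block diagonal.  Thus
   kappa_ij <> 0 forces b'_i / b_j <= n^O(n^2), which bounds b' kappa b^-1, and
   with it the entries of gamma = u' (b' kappa b^-1) u^-1, by n^O(n^2).  There
   are n^O(n^4) integer matrices with such entries.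

   Lower bound.  As 2 / sqrt 3 > 1, the sequence b may grow geometrically.  Let
   b_i be proportional to (9/8)^i, and let gamma be the identity plus a block Z
   of size h = n / 3 in the lower left corner, with entries between 0 and
   (9/8)^h / O(n).  Then b^-1 gamma b is close to the identity, so gamma b
   lies in the Siegel set just as b does.  There are exp (c h^3) such Z. *)
Require Import Defs.
From mathcomp Require Import all_boot all_order all_algebra.
From mathcomp Require Import finmap.
From mathcomp Require Import all_classical all_reals all_analysis.
From mathcomp Require Import perm zify ring lra.
Import Order.TTheory GRing.Theory Num.Theory.
Local Open Scope ring_scope.

Set Implicit Arguments.
Unset Strict Implicit.
Unset Printing Implicit Defensive.

(** * Pairs of reduced decompositions *)
Lemma chain_up (F : numDomainType) n (f : 'I_n -> F) (c : F) (p q : 'I_n) :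
  0 <= c -> (p <= q)%N ->
  (forall i j : 'I_n, (p <= i)%N -> (j <= q)%N -> nat_of_ord j = i.+1 ->
     f j <= c * f i) ->
  f q <= c ^+ (q - p) * f p.
Proof.
move=> c0 lepq step.
have: exists d, (nat_of_ord q = p + d)%N by exists (q - p)%N; lia.
case=> d; elim: d => [|d IHd] in q lepq step *.
  rewrite addn0 => /val_inj ->; by rewrite subnn mul1r.
move=> eqq; have ltq : (p + d < n)%N by have := ltn_ord q; lia.
have := IHd (Ordinal ltq) (leq_addr _ _) _ erefl => /= IH.
apply: le_trans (step (Ordinal ltq) q _ _ _) _ => //=; try lia.
have -> : (q - p = (p + d - p).+1)%N by lia.
rewrite exprS -mulrA ler_wpM2l // IH // => i j pi jd; apply: step => //; lia.
Qed.

(** The step inequality is asked only between [p] and [q]: it will be derived from a nonzero entry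
    [k i j], which controls only the steps separating [i] from [j]. *)
Lemma chain_down (F : numDomainType) n (f : 'I_n -> F) (c : F) (p q : 'I_n) :
  0 <= c -> (p <= q)%N ->
  (forall i j : 'I_n, (p <= i)%N -> (j <= q)%N -> nat_of_ord j = i.+1 ->
     f i <= c * f j) ->
  f p <= c ^+ (q - p) * f q.
Proof.
move=> c0 lepq step.
have: exists d, (nat_of_ord q = p + d)%N by exists (q - p)%N; lia.
case=> d; elim: d => [|d IHd] in q lepq step *.
  rewrite addn0 => /val_inj ->; by rewrite subnn mul1r.
move=> eqq; have ltq : (p + d < n)%N by have := ltn_ord q; lia.
have := IHd (Ordinal ltq) (leq_addr _ _) _ erefl => /= IH.
apply: le_trans (IH _) _; first by move=> i j pi jd; apply: step => //; lia.
have -> : (q - p = (p + d - p).+1)%N by lia.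
rewrite exprSr -mulrA ler_wpM2l ?exprn_ge0 // step //=; lia.
Qed.

Lemma intr_norm_ge1 (F : numDomainType) (z : int) : z != 0 -> 1 <= `|z%:~R : F|.
Proof. by move=> z0; rewrite -intr_norm ler1z; lia. Qed.

Lemma orthogonal_row_norm (F : realFieldType) n (k : 'M[F]_n) i :
  k *m k^T = 1%:M -> \sum_j k i j ^+ 2 = 1.
Proof.
move=> /matrixP /(_ i i); rewrite [RHS]mxE eqxx mulr1n => <-; rewrite mxE.
by apply: eq_bigr => j _; rewrite mxE expr2.
Qed.

Lemma orthogonal_norm_le1 (F : realFieldType) n (k : 'M[F]_n) i j :
  k *m k^T = 1%:M -> `|k i j| <= 1.
Proof.
move=> /(orthogonal_row_norm i) kk; have : k i j ^+ 2 <= 1.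
  rewrite -[leRHS]kk (bigD1 j) //= lerDl sumr_ge0 // => q _; exact: sqr_ge0.
by rewrite -real_normK ?num_real // -{1}[1](expr1n _ 2) ler_sqr // nnegrE.
Qed.

Lemma orthogonal_trC (F : realFieldType) n (k : 'M[F]_n) :
  k *m k^T = 1%:M -> k^T *m k = 1%:M.
Proof. exact: mulmx1C. Qed.

(* Counting squares: the first [l + 1] columns carry [l + 1] inside the
   upper left block, so do the first [l + 1] rows. *)
Lemma orthogonal_block_diag (F : realFieldType) n (k : 'M[F]_n) (l : nat) :
  k *m k^T = 1%:M ->
  (forall p q : 'I_n, (q <= l)%N -> (l < p)%N -> k p q = 0) ->
  forall p q : 'I_n, (p <= l)%N -> (l < q)%N -> k p q = 0.
Proof.
move=> kk k0 p q lep ltq.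
have row1 i := orthogonal_row_norm i kk.
have col1 j : \sum_i k i j ^+ 2 = 1.
  have /(orthogonal_row_norm j) : k^T *m k^T^T = 1%:M by rewrite trmxK orthogonal_trC.
  by under eq_bigr do rewrite mxE.
have eqcol : \sum_(i : 'I_n | (i <= l)%N) \sum_(j : 'I_n | (j <= l)%N) k i j ^+ 2
    = \sum_(j : 'I_n | (j <= l)%N) 1.
  rewrite exchange_big /=; apply: eq_bigr => j lej.
  rewrite -(col1 j) [RHS](bigID (fun i : 'I_n => (i <= l)%N)) /=.
  rewrite [X in _ + X]big1 ?addr0 // => i; rewrite -ltnNge => lti.
  by rewrite k0 // expr0n.
have eqrow : \sum_(i : 'I_n | (i <= l)%N) \sum_j k i j ^+ 2
    = \sum_(i : 'I_n | (i <= l)%N) 1 by apply: eq_bigr => i _; exact: row1.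
have ksq (i : 'I_n) : \sum_j k i j ^+ 2 =
    \sum_(j : 'I_n | (j <= l)%N) k i j ^+ 2 + \sum_(j : 'I_n | (l < j)%N) k i j ^+ 2.
  rewrite (bigID (fun j : 'I_n => (j <= l)%N)) /=; congr (_ + _).
  by apply: eq_bigl => j; rewrite -ltnNge.
move: eqrow; under eq_bigr do rewrite ksq.
rewrite big_split /= eqcol -[RHS]addr0 => /addrI /eqP.
rewrite psumr_eq0; last by move=> i _; apply: sumr_ge0 => j _; exact: sqr_ge0.
move=> /allP /(_ p (mem_index_enum _)); rewrite lep /=.
rewrite psumr_eq0; last by move=> j _; exact: sqr_ge0.
by move=> /allP /(_ q (mem_index_enum _)); rewrite ltq /= sqrf_eq0 => /eqP.
Qed.

(* Only the first nonzero entry of row [p] of [d] sees the unipotent factor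
   [u'], so there integrality of [d] bounds [b'] from above. *)
Lemma diag_le_of_int_neq0 (F : realFieldType) n (d : 'M[int]_n)
    (u' u k : 'M[F]_n) (b' b : 'rV[F]_n) (T : F) (p q : 'I_n) :
  (forall i, u' i i = 1) -> (forall i j : 'I_n, (j < i)%N -> u' i j = 0) ->
  (forall i j : 'I_n, (j < i)%N -> u i j = 0) ->
  (forall i j, `|u i j| <= 1) -> (forall i j, `|k i j| <= 1) ->
  (forall i, 0 < b' 0 i) -> (forall i, 0 < b 0 i) ->
  0 <= T ->
  (forall i j : 'I_n, (i <= j)%N -> b' 0 j <= T * b' 0 i) ->
  (forall i j : 'I_n, (i <= j)%N -> b 0 j <= T * b 0 i) ->
  map_mx intr d *m u' *m diag_mx b' = u *m diag_mx b *m k ->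
  d p q != 0 -> b' 0 q <= n%:R * T ^+ 2 * b 0 p.
Proof.
move=> u'1 u'0 u0 ule1 kle1 b'0 b0 T0 b'T bT eqd dpq.
case: (arg_minnP (fun j : 'I_n => nat_of_ord j) (P := fun j => d p j != 0) dpq).
move=> r dpr rmin.
have du' : (map_mx intr d *m u') p r = (d p r)%:~R :> F.
  rewrite mxE (bigD1 r) //= u'1 mulr1 mxE big1 ?addr0 // => j jr.
  have [ltrj|] := ltnP r j; first by rewrite u'0 // mulr0.
  rewrite mxE leq_eqVlt => /orP[/eqP/val_inj e|ltjr]; first by rewrite e eqxx in jr.
  have -> : d p j = 0; last by rewrite mul0r.
  by apply/eqP/negP => /negP /rmin; lia.
have b'r : b' 0 r <= n%:R * (T * b 0 p).
  have /matrixP/(_ p r) := eqd; rewrite mul_mx_diag mxE du' => eqpr.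
  have /le_trans : b' 0 r <= `|(d p r)%:~R * b' 0 r|.
    by rewrite normrM (gtr0_norm (b'0 r)) ler_peMl ?intr_norm_ge1 // ltW.
  apply; rewrite eqpr mul_mx_diag mxE.
  apply: le_trans (ler_norm_sum _ _ _) _.
  have -> : n%:R * (T * b 0 p) = \sum_(j < n) (T * b 0 p).
    by rewrite sumr_const card_ord mulr_natl.
  apply: ler_sum => j _; rewrite mxE.
  have [ltjp|lepj] := ltnP j p.
    by rewrite u0 // !mul0r normr0 mulr_ge0 // (ltW (b0 p)).
  rewrite !normrM (gtr0_norm (b0 j)); apply: le_trans (bT p j lepj).
  rewrite -[leRHS]mulr1 ler_pM ?mulr_ge0 // ?(ltW (b0 j)) //.
  by rewrite -[leRHS]mul1r ler_wpM2r // (ltW (b0 j)).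
apply: le_trans (b'T r q (rmin q dpq)) _.
by apply: le_trans (ler_wpM2l T0 b'r) _; rewrite le_eqVlt; apply/orP; left; apply/eqP; ring.
Qed.

(** A nonzero Leibniz sum has a nonzero term. *)
Lemma det_neq0_perm (F : comNzRingType) n (A : 'M[F]_n) :
  \det A != 0 -> exists s : 'S_n, forall i, A i (s i) != 0.
Proof.
move=> dA.
have [s hs|no] := pickP (fun s : 'S_n => [forall i, A i (s i) != 0]).
  by exists s; exact/forallP.
case/negP: dA; apply/eqP; rewrite /determinant big1 // => s _.
have /negbT := no s; rewrite negb_forall => /existsP[i]; rewrite negbK => /eqP Ai.
by rewrite (bigD1 i) //= Ai mul0r mulr0.
Qed.

(** Otherwise [s] would inject the indices at least [i] into those strictly above [i], which are one
    fewer. *)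
Lemma perm_pigeonhole n (s : 'S_n) (i : 'I_n) :
  exists2 p : 'I_n, (i <= p)%N & (s p <= i)%N.
Proof.
have [p /andP[ip sp]|no] := pickP (fun p : 'I_n => (i <= p)%N && (s p <= i)%N).
  by exists p.
pose A := [pred p : 'I_n | (i <= p)%N]; pose B := [pred p : 'I_n | (i < p)%N].
have sub : [seq s p | p in A] \subset B.
  apply/fintype.subsetP => _ /fintype.imageP[p + ->]; rewrite !inE => ip.
  by have := no p; rewrite ip /= ltnNge => ->.
have := subset_leq_card sub; rewrite fintype.card_image; last exact: perm_inj.
rewrite (cardD1 i A) inE leqnn add1n ltnNge.
by rewrite (eq_card (A := [predD1 A & i]) (B := B)) ?leqnn // => p; rewrite !inE ltn_neqAle eq_sym.
Qed.

(** The unipotent and diagonal parts of a Siegel point in the coordinates [b = a^-1]: the condition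
    [a_i / a_(i+1) <= t] becomes [b_(i+1) <= t * b_i]. So [b] rises slowly but may drop arbitrarily
    fast. *)
Definition reduced_pair (F : realFieldType) n (t : F) (u : 'M[F]_n) (b : 'rV[F]_n) :=
  [/\ forall i, u i i = 1,
      forall i j : 'I_n, (j < i)%N -> u i j = 0,
      forall i j : 'I_n, (i < j)%N -> `|u i j| <= 1 / 2,
      forall i, 0 < b 0 i &
      forall i j : 'I_n, nat_of_ord j = i.+1 -> b 0 j <= t * b 0 i].

Lemma reduced_pair_norm_le1 (F : realFieldType) n (t : F) (u : 'M[F]_n) b i j :
  reduced_pair t u b -> `|u i j| <= 1.
Proof.
case=> u1 u0 uh _ _; case: (ltngtP i j) => [ij|ji|/val_inj->].
- by apply: le_trans (uh _ _ ij) _; lra.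
- by rewrite u0 // normr0.
- by rewrite u1 normr1.
Qed.

Lemma reduced_pair_chain (F : realFieldType) n (t : F) (u : 'M[F]_n) b (i j : 'I_n) :
  1 <= t -> reduced_pair t u b -> (i <= j)%N -> b 0 j <= t ^+ n * b 0 i.
Proof.
move=> t1 [_ _ _ b0 bt] ij.
have t0 : 0 <= t by apply: le_trans t1.
apply: le_trans (chain_up (f := fun i => b 0 i) t0 ij _) _.
  by move=> p q _ _; exact: bt.
rewrite ler_wpM2r ?(ltW (b0 i)) // ler_weXn2l //.
by have := ltn_ord j; lia.
Qed.

(** * Entry bounds for an integer matrix carrying one reduced pair to another *)

Section IntertwinedPairs.
Variables (F : realFieldType) (n : nat) (t : F).
Variables (g d : 'M[int]_n) (u u' k : 'M[F]_n) (b b' : 'rV[F]_n).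
Hypothesis t1 : 1 <= t.
Hypothesis gd : g *m d = 1%:M.
Hypothesis ub : reduced_pair t u b.
Hypothesis ub' : reduced_pair t u' b'.
Hypothesis kk : k *m k^T = 1%:M.
Hypothesis gub : map_mx intr g *m u *m diag_mx b = u' *m diag_mx b' *m k.

Let T := t ^+ n.
Let G := n%:R ^+ 2 * T ^+ 8.

Let b0 i : 0 < b 0 i. Proof. by case: ub. Qed.
Let b'0 i : 0 < b' 0 i. Proof. by case: ub'. Qed.
Let T1 : 1 <= T. Proof. exact: exprn_ege1. Qed.
Let T0 : 0 <= T. Proof. exact: le_trans T1. Qed.

Let Tn m : 0 <= T ^+ m. Proof. exact: exprn_ge0. Qed.

Let Gn m : 0 <= G ^+ m.
Proof. by apply: exprn_ge0; rewrite mulr_ge0 ?Tn ?exprn_ge0. Qed.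

(** The relation [gub] solved for the inverse: the two pairs exchange roles and [k] becomes [k^T],
    so integrality of [d] can be exploited like that of [g]. *)
Let dub : map_mx intr d *m u' *m diag_mx b' = u *m diag_mx b *m k^T.
Proof.
have dg : map_mx intr d *m map_mx intr g = 1%:M :> 'M[F]_n.
  by rewrite -map_mxM (mulmx1C gd) map_mx1.
have : map_mx intr d *m (map_mx intr g *m u *m diag_mx b) *m k^T
     = map_mx intr d *m (u' *m diag_mx b' *m k) *m k^T by rewrite gub.
by rewrite !mulmxA dg mul1mx -!mulmxA kk mulmx1 !mulmxA => ->.
Qed.

Lemma intertwined_entry p q : g p q != 0 -> b 0 q <= n%:R * T ^+ 2 * b' 0 p.
Proof.
case: (ub) (ub') => u1 u0 _ _ _ [_ u'0 _ _ _].
apply: (diag_le_of_int_neq0 u1 u0 u'0 _ _ b0 b'0 T0 _ _ gub).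
- by move=> i j; exact: reduced_pair_norm_le1 ub'.
- by move=> i j; exact: orthogonal_norm_le1.
- by move=> i j; exact: reduced_pair_chain ub.
- by move=> i j; exact: reduced_pair_chain ub'.
Qed.

Lemma intertwined_entry_inv p q : d p q != 0 -> b' 0 q <= n%:R * T ^+ 2 * b 0 p.
Proof.
case: (ub) (ub') => _ u0 _ _ _ [u'1 u'0 _ _ _].
apply: (diag_le_of_int_neq0 u'1 u'0 u0 _ _ b'0 b0 T0 _ _ dub).
- by move=> i j; exact: reduced_pair_norm_le1 ub.
- by move=> i j; rewrite mxE; exact: orthogonal_norm_le1.
- by move=> i j; exact: reduced_pair_chain ub'.
- by move=> i j; exact: reduced_pair_chain ub.
Qed.

(** Since [d] is invertible, some permutation [s] runs through nonzero entries of [d], and some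
    [p >= i] has [s p <= i]. Passing from [b'] at [i] to [b'] at [s p], to [b] at [p], to [b] at [i]
    costs the factors [T], [n * T^2] and [T]. *)
Lemma intertwined_diag i : b' 0 i <= n%:R * T ^+ 4 * b 0 i.
Proof.
have d0 : \det d != 0.
  apply/eqP => d0; have /(congr1 determinant) := gd.
  by rewrite det_mulmx d0 mulr0 det1.
have [s ds] := det_neq0_perm d0; have [p ip sp] := perm_pigeonhole s i.
apply: le_trans (reduced_pair_chain t1 ub' sp) _.
apply: le_trans (ler_wpM2l T0 (intertwined_entry_inv (ds p))) _.
have /(ler_wpM2l (x := T * (n%:R * T ^+ 2))) := reduced_pair_chain t1 ub ip.
rewrite !mulr_ge0 ?Tn // => /(_ isT); rewrite -/T.
rewrite !mulrA => /le_trans; apply; rewrite le_eqVlt; apply/orP; left; apply/eqP; ring.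
Qed.

(** The chain runs through [b] at [q], [b'] at [p] and [b] at [p]; its factors [T], [n * T^2],
    [n * T^4] and [T] multiply to [G]. Read backwards, a drop of [b] by more than [G] produces a
    zero block in [g]. *)
Lemma intertwined_gap (p q i j : 'I_n) :
  g p q != 0 -> (q <= i)%N -> (j <= p)%N -> b 0 i <= G * b 0 j.
Proof.
move=> gpq qi jp.
have c0 : 0 <= n%:R * T ^+ 2 :> F by rewrite mulr_ge0 ?Tn.
have c1 : 0 <= n%:R * T ^+ 4 :> F by rewrite mulr_ge0 ?Tn.
apply: le_trans (reduced_pair_chain t1 ub qi) _.
apply: le_trans (ler_wpM2l T0 (intertwined_entry gpq)) _.
apply: le_trans (ler_wpM2l T0 (ler_wpM2l c0 (intertwined_diag p))) _.
apply: le_trans (ler_wpM2l T0 (ler_wpM2l c0 (ler_wpM2l c1 (reduced_pair_chain t1 ub jp)))) _.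
by rewrite -/T /G le_eqVlt; apply/orP; left; apply/eqP; ring.
Qed.

(* A gap larger than [G] in the sequence [b] makes [g] block triangular at
   the gap, hence [k] too, and an orthogonal block triangular matrix is block
   diagonal. *)
Lemma intertwined_orthogonal (i j : 'I_n) :
  k i j != 0 -> b' 0 i <= n%:R * T ^+ 4 * (G ^+ n * T) * b 0 j.
Proof.
move=> kij; have G0 : 0 <= G by rewrite mulr_ge0 ?Tn ?exprn_ge0.
have n1 : 1 <= n%:R :> F by rewrite ler1n; have := ltn_ord i; lia.
have G1 : 1 <= G.
  by rewrite /G -[leLHS]mulr1 ler_pM //; [exact: exprn_ege1 n1|exact: exprn_ege1 T1].
have Gn1 m : 1 <= G ^+ m by exact: exprn_ege1.
have c1 : 0 <= n%:R * T ^+ 4 :> F by rewrite mulr_ge0 ?Tn.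
apply: le_trans (intertwined_diag i) _; rewrite -[leRHS]mulrA ler_wpM2l //.
case: (leqP j i) => [ji|ij].
  apply: le_trans (reduced_pair_chain t1 ub ji) _.
  by rewrite ler_wpM2r ?(ltW (b0 j)) // ler_peMl.
have : b 0 i <= G ^+ (j - i) * b 0 j.
  apply: (chain_down (f := fun i => b 0 i) G0 (ltnW ij)) => l l' il l'j ll'.
  rewrite leNgt; apply/negP => gap; case/eqP: kij.
  have g0 (p q : 'I_n) : (q <= l)%N -> (l < p)%N -> g p q = 0.
    move=> ql lp; apply/eqP/negP => /negP gpq; move: gap; rewrite ltNge.
    by rewrite (intertwined_gap gpq) // ll'.
  apply: (orthogonal_block_diag (l := l) kk); last 2 first.
  - by [].
  - by rewrite -ll'.
  move=> p q ql; apply: contraTeq => kpq.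
  (* Let [r] be the last row with a nonzero entry in column [q] of [k]. If [l < r], entry [(r, q)]
     of [gub] is zero on the left by the zero block of [g], while on the right only the diagonal of
     [u'] contributes, leaving [b' 0 r * k r q]; so [k r q] would vanish. *)
  case: (arg_maxnP (fun p : 'I_n => nat_of_ord p) (P := fun p => k p q != 0) kpq).
  move=> r krq rmax; rewrite -leqNgt; apply: leq_trans (rmax _ kpq) _.
  rewrite /= leqNgt; apply/negP => lr; case/eqP: krq.
  case: (ub) (ub') => _ u0 _ _ _ [u'1 u'0 _ _ _].
  have /matrixP/(_ r q) := gub; rewrite mul_mx_diag mxE [X in X * _]mxE.
  rewrite big1 => [|m _]; last first.
    case: (leqP m q) => mq; last by rewrite u0 ?mulr0.
    by rewrite mxE g0 ?mul0r // (leq_trans mq).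
  rewrite mul0r mxE (bigD1 r) //= big1 ?addr0 => [|m mr]; last first.
    rewrite mul_mx_diag mxE; case: (ltngtP m r) => [?|rm|/val_inj /eqP]; last by rewrite (negbTE mr).
      by rewrite u'0 // !mul0r.
    by apply/eqP; rewrite mulf_eq0; apply/orP; right; apply: contraTT rm => /rmax /=; rewrite -leqNgt.
  by rewrite mul_mx_diag mxE u'1 mul1r => /esym/eqP; rewrite mulf_eq0 gt_eqF //= => /eqP.
move=> /le_trans; apply; rewrite ler_wpM2r ?(ltW (b0 j)) //.
rewrite -[leLHS]mulr1 ler_pM // ?exprn_ge0 // ler_weXn2l //.
by have := ltn_ord j; lia.
Qed.

(** Wherever [k] is nonzero, the ratio of [b'] to [b] is bounded, so [g * u = u' * b' * k * b^-1]
    has bounded entries; it remains to undo the unipotent [u]. *)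
Lemma intertwined_bound (i j : 'I_n) :
  `|g i j|%:~R <= n%:R * (n%:R * T ^+ 4 * (G ^+ n * T)) * 2 ^+ j :> F.
Proof.
set X := n%:R * T ^+ 4 * (G ^+ n * T).
have X0 : 0 <= X by rewrite !mulr_ge0 ?Tn ?Gn.
have gu q : `|(map_mx intr g *m u) i q| <= n%:R * X.
  rewrite -(ler_pM2r (b0 q)) -(gtr0_norm (b0 q)) -normrM (gtr0_norm (b0 q)).
  have /matrixP/(_ i q) := gub; rewrite mul_mx_diag mxE => ->.
  rewrite mul_mx_diag mxE; apply: le_trans (ler_norm_sum _ _ _) _.
  have -> : n%:R * X * b 0 q = \sum_(m < n) (X * b 0 q).
    by rewrite sumr_const card_ord mulr_natl mulrnAl.
  apply: ler_sum => m _; rewrite mxE.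
  have Xb : 0 <= X * b 0 q by rewrite mulr_ge0 // ltW.
  have [->|kmq] := eqVneq (k m q) 0; first by rewrite mulr0 normr0.
  apply: le_trans (intertwined_orthogonal kmq).
  rewrite !normrM (gtr0_norm (b'0 m)) -[leRHS]mulr1 -[b' 0 m in leRHS]mul1r.
  rewrite !ler_pM ?mulr_ge0 ?(ltW (b'0 m)) //.
    exact: reduced_pair_norm_le1 ub'.
  exact: orthogonal_norm_le1.
rewrite intr_norm; case: (ub) => u1 u0 uh _ _.
(* Column [j] of [g] is column [j] of [g * u] minus combinations of earlier columns of [g] with
   coefficients at most 1 in absolute value; the factor [2 ^+ j] is [1] plus the sum of [2 ^+ q]
   over [q < j]. *)
have [m] := ubnP (nat_of_ord j); elim: m => // m IHm in j * => /ltnSE jm.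
have /(_ j) := gu; rewrite mxE (bigD1 j) //= u1 mulr1 mxE.
set rest := \sum_(q < n | _) _ => gur.
suff rest_le : `|rest| <= n%:R * X * (2 ^+ j - 1).
  rewrite -[X in `|X|](addrK rest); apply: le_trans (ler_normB _ _) _.
  by apply: le_trans (lerD gur rest_le) _; rewrite mulrBr mulr1 addrC subrK.
have jn := ltnW (ltn_ord j).
rewrite subrX1 [2 - 1](_ : _ = 1); last by ring.
rewrite mul1r -(big_ord_narrow jn (F := fun q : 'I_n => 2 ^+ q)) mulr_sumr.
rewrite [leRHS]big_mkcond /= /rest [X in `|X|]big_mkcond /=.
apply: le_trans (ler_norm_sum _ _ _) _; apply: ler_sum => q _.
have Y0 : 0 <= n%:R * X * 2 ^+ q by rewrite (mulr_ge0 (mulr_ge0 _ X0)) ?ler0n ?exprn_ge0 ?ler0n.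
case: (ltngtP q j) => [qj|jq|/val_inj ->]; last first.
  by rewrite eqxx /= normr0.
  by rewrite u0 // mulr0 if_same normr0.
rewrite -val_eqE /= ltn_eqF //= normrM mxE -[leRHS]mulr1 ler_pM //.
  by apply: IHm; lia.
by apply: le_trans (uh _ _ qj) _; lra.
Qed.

End IntertwinedPairs.

(** * Matrices close to the identity *)

(* Schur complements: eliminating the last index turns entrywise distance
   [eta] to the identity into at most [eta + eta^2 / (1 - eta) =
   eta / (1 - eta)], that is [1 / eta] into [1 / eta - 1]. *)
Lemma near_id_UDU (F : realFieldType) (c : F) n (S : 'M[F]_n) :
  1 <= c -> S^T = S ->
  (forall i j, `|S i j - (i == j)%:R| <= (n%:R + c)^-1) ->
  exists (U : 'M[F]_n) (d : 'rV[F]_n),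
    [/\ forall i, U i i = 1,
        forall i j : 'I_n, (j < i)%N -> U i j = 0,
        forall i j : 'I_n, (i < j)%N -> `|U i j| <= c^-1,
        forall i, `|d 0 i - 1| <= (1 + c)^-1 &
        S = U *m diag_mx d *m U^T].
Proof.
move=> c1; elim: n S => [|n IHn].
  move=> S _ _; exists 1%:M, 0; split; try by case.
  by apply/matrixP; case.
rewrite -addn1 => S Ssym Sid.
set nc : F := n%:R + c; have nc1 : 1 <= nc by rewrite -[1]add0r lerD.
have ncc : c <= nc by rewrite -[c]add0r lerD.
set eta := nc^-1; have nc0 : 0 < nc by lra.
have eta1E : ((n + 1)%:R + c)^-1 = (1 + nc)^-1 :> F.
  by rewrite natrD addrAC [in RHS]addrC.
set e1 := (1 + nc)^-1 in eta1E *; rewrite {}eta1E in Sid.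
have e10 : 0 < e1 by rewrite invr_gt0; lra.
pose s := S (rshift n ord0) (rshift n ord0).
pose w : 'cV[F]_n := \col_i S (lshift 1 i) (rshift n ord0).
have sE : `|s - 1| <= e1 by have := Sid (rshift n ord0) (rshift n ord0); rewrite eqxx.
have wE i : `|w i 0| <= e1.
  have := Sid (lshift 1 i) (rshift n ord0); rewrite mxE.
  by rewrite eq_lrshift subr0.
have e1nc : e1 * (1 + nc) = 1 by rewrite mulVf //; lra.
have s_ge : e1 * nc <= s by move: sE; rewrite ler_norml => /andP[]; lra.
have s0 : 0 < s by apply: lt_le_trans s_ge; rewrite mulr_gt0.
have ws i : `|w i 0 / s| <= eta.
  rewrite normrM normfV (gtr0_norm s0) ler_pdivrMr //.
  apply: le_trans (wE i) _; rewrite mulrC ler_pdivlMr //.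
pose S' : 'M[F]_n := \matrix_(i, j) (ulsubmx S i j - w i 0 * w j 0 / s).
have ulE i j : ulsubmx S i j = S (lshift 1 i) (lshift 1 j) by rewrite !mxE.
have S'sym : S'^T = S'.
  apply/matrixP => i j; rewrite mxE [LHS]mxE [RHS]mxE [w j 0 * _]mulrC !ulE.
  by rewrite -{1}Ssym mxE.
have S'id i j : `|S' i j - (i == j)%:R| <= (n%:R + c)^-1.
  rewrite -/nc -/eta mxE ulE addrAC; apply: le_trans (ler_normB _ _) _.
  have e1eta : e1 + e1 * eta = eta.
    by rewrite /e1 /eta; field; rewrite !gt_eqF //; lra.
  rewrite -e1eta lerD //.
  by rewrite -mulrA normrM ler_pM.
have [U [d [U1 U0 Uc dE SE]]] := IHn S' S'sym S'id.
(* The pivot is the last diagonal entry [s], so that the factor with last column [w / s] stays upper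
   triangular; [U] and [d] factor the Schur complement [S']. *)
exists (block_mx U (s^-1 *: w) 0 1%:M), (row_mx d s%:M); split.
- move=> i; case: (split_ordP i) => p ->; rewrite ?block_mxEul ?block_mxEdr //.
  by rewrite ord1 mxE.
- move=> i j; case: (split_ordP i) => p ->; case: (split_ordP j) => q ->.
  + by rewrite block_mxEul => /U0.
  + by rewrite /= ltnNge; have := ltn_ord p; lia.
  + by rewrite block_mxEdl mxE.
  + by rewrite !ord1 ltnn.
- move=> i j; case: (split_ordP i) => p ->; case: (split_ordP j) => q ->.
  + by rewrite block_mxEul => /Uc.
  + move=> _; rewrite block_mxEur ord1 mxE mulrC; apply: le_trans (ws p) _.
    by rewrite lef_pV2 ?posrE //; lra.
  + by rewrite block_mxEdl mxE normr0 invr_ge0; lra.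
  + by rewrite !ord1 ltnn.
- move=> i; case: (split_ordP i) => p ->; first by rewrite row_mxEl.
  rewrite row_mxEr ord1 mxE mulr1n; apply: le_trans sE _.
  by rewrite lef_pV2 ?posrE //; lra.
rewrite diag_mx_row tr_block_mx !mulmx_block.
rewrite trmx1 trmx0 linearZ /= !(mul0mx, mulmx0, mul1mx, mulmx1, add0r, addr0).
have -> : diag_mx (s%:M : 'rV_1) = s%:M by apply/matrixP => i j; rewrite !ord1 !mxE.
rewrite -SE -[LHS]submxK !mul_mx_scalar !mul_scalar_mx !scalerA divff ?gt_eqF //.
rewrite !scale1r; congr block_mx; apply/matrixP => i j; rewrite ?ord1.
- rewrite ulE 2![in RHS]mxE [(w *m _) i j]mxE big_ord1 [(_ *: w^T) 0 j]mxE [w^T 0 j]mxE ulE.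
  by rewrite mulrCA -mulrA [w i 0 * (w j 0 * _)]mulrA [s^-1 * _]mulrC subrK.
- by rewrite !mxE.
- by rewrite -Ssym !mxE.
- by rewrite !mxE.
Qed.

Local Open Scope classical_set_scope.
Local Open Scope ring_scope.

(** * Siegel sets *)

Lemma invmx_diag (F : fieldType) n (d : 'rV[F]_n) :
  (forall i, d 0 i != 0) -> invmx (diag_mx d) = diag_mx (map_mx GRing.inv d).
Proof.
move=> d0; have dV : diag_mx d *m diag_mx (map_mx GRing.inv d) = 1%:M.
  apply/matrixP => i j; rewrite mul_mx_diag !mxE.
  by case: eqP => [->|_]; rewrite ?mulr1n ?mulr0n ?mul0r ?mulfV.
have [dU _] := mulmx1_unit dV.
by rewrite -[LHS]mulmx1 -dV mulmxA mulVmx // mul1mx.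
Qed.

Lemma Siegel_setP (R : realType) n (t : R) (g : 'M[R]_n) :
  0 < t ->
  Siegel_set n t (1 / 2) g <->
  exists u b k, [/\ reduced_pair t u b, \prod_i b 0 i = 1, SO_set R n k &
                    g = u *m diag_mx b *m k].
Proof.
move=> t0; split.
  case=> u [a [k [[[u1 u0] uh] [[d [d0 d1] <-] dt] kSO ->]]].
  exists u, (map_mx GRing.inv d), k; split=> //.
  - split=> // [i|i j ji]; first by rewrite mxE invr_gt0.
    have := dt i j ji; rewrite !mxE !eqxx !mulr1n.
    by move=> dij; rewrite ler_pdivlMr ?d0 // mulrC.
  - under eq_bigr do rewrite mxE.
    by rewrite prodfV d1 invr1.
  - by rewrite invmx_diag // => i; rewrite gt_eqF.
case=> u [b [k [[u1 u0 uh b0 bt] b1 kSO ->]]].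
exists u, (diag_mx (map_mx GRing.inv b)), k; split=> //.
- split; last first.
    move=> i j ji; rewrite !mxE !eqxx !mulr1n invrK.
    by rewrite mulrC ler_pdivrMr ?b0 // bt.
  exists (map_mx GRing.inv b) => //; split=> [i|]; first by rewrite mxE invr_gt0.
  by under eq_bigr do rewrite mxE; rewrite prodfV b1 invr1.
- rewrite invmx_diag => [|i]; last by rewrite mxE invr_eq0 gt_eqF.
  by congr (_ *m diag_mx _ *m _); apply/matrixP => i j; rewrite !mxE invrK.
Qed.

Lemma det_upper_unitri (F : comNzRingType) n (u : 'M[F]_n) :
  (forall i, u i i = 1) -> (forall i j : 'I_n, (j < i)%N -> u i j = 0) ->
  \det u = 1.
Proof.
move=> u1 u0; rewrite -det_tr det_trig; first by rewrite big1 // => i _; rewrite mxE.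
by apply/is_trig_mxP => i j ij; rewrite mxE u0.
Qed.

(* Write [g * b = b * W] with [W] close to the identity: if [W * W^T = U * D * U^T],
   then [b * U * b^-1 * (b * sqrt D)] is the Siegel part of [g * b].  The
   step [9 / 8] of [b] is chosen so that [(9/8)^2 * (42/41) <= (4/3) * (40/41)],
   where [40/41] and [42/41] bound the entries of [D]. *)
Lemma reduced_of_near_diag (R : realType) n (t : R) (g : 'M[R]_n) (b : 'rV[R]_n) :
  0 <= t -> 4 / 3 <= t ^+ 2 ->
  \det g = 1 -> (forall i, 0 < b 0 i) -> \prod_i b 0 i = 1 ->
  (forall i j : 'I_n, (i <= j)%N -> b 0 i <= b 0 j) ->
  (forall i j : 'I_n, nat_of_ord j = i.+1 -> b 0 j <= 9 / 8 * b 0 i) ->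
  (forall i j, `|g i j * b 0 j / b 0 i - (i == j)%:R| <= (3 * (n%:R + 40))^-1) ->
  Siegel_set n t (1 / 2) (g *m diag_mx b).
Proof.
move=> t0 t43 g1 b0 b1 bmono bstep gb.
have tpos : 0 < t.
  by rewrite lt_neqAle t0 andbT; apply/eqP => t00; move: t43; rewrite -t00 expr0n /=; lra.
have nb i : b 0 i != 0 by rewrite gt_eqF.
have N40 : 0 < n%:R + 40 :> R by have : 0 <= n%:R :> R := ler0n _ _; lra.
pose W : 'M[R]_n := \matrix_(i, j) (g i j * b 0 j / b 0 i).
have bW : diag_mx b *m W = g *m diag_mx b.
  by apply/matrixP => i j; rewrite mul_diag_mx mul_mx_diag !mxE mulrC divfK.
pose S := W *m W^T.
have Ssym : S^T = S by rewrite trmx_mul trmxK.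
(* With [W = 1 + V], the difference [S - 1] is [V + V^T + V * V^T]. Each term is at most [th], a
   third of the tolerance, the quadratic one because [n * th <= 1]. *)
have Sid i j : `|S i j - (i == j)%:R| <= (n%:R + 40)^-1.
  set th := (3 * (n%:R + 40))^-1 : R.
  pose V : 'M[R]_n := \matrix_(i, j) (W i j - (i == j)%:R).
  have Vle p q : `|V p q| <= th by rewrite !mxE; exact: gb.
  have WE : W = 1%:M + V by apply/matrixP => p q; rewrite !mxE addrC subrK.
  have -> : S i j - (i == j)%:R = V i j + V j i + (V *m V^T) i j.
    rewrite /S WE linearD /= trmx1 mulmxDl !mulmxDr !mul1mx mulmx1.
    have addE (A B : 'M[R]_n) : (A + B) i j = A i j + B i j by rewrite mxE.
    by rewrite !addE [1%:M i j]mxE [V^T i j]mxE; ring.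
  have VV : `|(V *m V^T) i j| <= n%:R * th ^+ 2.
    rewrite mxE; apply: le_trans (ler_norm_sum _ _ _) _.
    have -> : n%:R * th ^+ 2 = \sum_(m < n) th ^+ 2.
      by rewrite sumr_const card_ord mulr_natl.
    by apply: ler_sum => m _; rewrite normrM [V^T _ _]mxE expr2 ler_pM.
  have nth : n%:R * th ^+ 2 <= th.
    have th0 : 0 < th by rewrite invr_gt0 mulr_gt0.
    have : n%:R * th <= 1.
      rewrite ler_pdivrMr ?mulr_gt0 // mul1r.
      by have : 0 <= n%:R :> R := ler0n _ _; lra.
    by move=> nt; rewrite expr2 mulrA ger_pMl.
  have -> : (n%:R + 40)^-1 = th + th + th.
    by rewrite /th; field; rewrite gt_eqF.
  apply: le_trans (ler_normD _ _) _; apply: lerD; last exact: le_trans nth.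
  by apply: le_trans (ler_normD _ _) _; apply: lerD.
have c40 : 1 <= 40 :> R by rewrite ler1n.
have [U [d [U1 U0 Uc dE SE]]] := near_id_UDU c40 Ssym Sid.
have e41 : (1 + 40)^-1 = 1 / 41 :> R by field.
rewrite {}e41 in dE.
have dlo i : 40 / 41 <= d 0 i.
  have := dE i; rewrite ler_norml => /andP[]; lra.
have dhi i : d 0 i <= 42 / 41.
  have := dE i; rewrite ler_norml => /andP[]; lra.
have d0 i : 0 < d 0 i by have := dlo i; lra.
pose u : 'M[R]_n := \matrix_(i, j) (U i j * b 0 i / b 0 j).
pose b' : 'rV[R]_n := \row_i (b 0 i * Num.sqrt (d 0 i)).
have b'0 i : 0 < b' 0 i by rewrite mxE mulr_gt0 // sqrtr_gt0.
have ured : reduced_pair t u b'.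
  split=> // [i|i j ji|i j ij|i j ji].
  - by rewrite mxE U1 mul1r divff.
  - by rewrite mxE U0 // !mul0r.
  (* Conjugation by [b] multiplies the entry by [b_i / b_j], which is at most 1 above the diagonal
     because [b] is nondecreasing. *)
  - rewrite mxE -mulrA normrM; apply: (@le_trans _ _ ((40)^-1 * 1)); last lra.
    apply: ler_pM => //; first exact: Uc.
    rewrite ger0_norm ?divr_ge0 ?(ltW (b0 _)) //.
    by rewrite ler_pdivrMr // mul1r bmono // ltnW.
  - rewrite -ler_sqr ?nnegrE ?mulr_ge0 ?(ltW (b'0 _)) //.
    rewrite !mxE !exprMn !sqr_sqrtr ?(ltW (d0 _)) //.
    have bij : b 0 j ^+ 2 <= (9 / 8 * b 0 i) ^+ 2.
      have c98 : 0 <= 9 / 8 :> R by lra.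
      by rewrite ler_sqr ?bstep // nnegrE ?mulr_ge0 ?(ltW (b0 _)).
    apply: (@le_trans _ _ ((9 / 8 * b 0 i) ^+ 2 * (42 / 41))).
      by rewrite ler_pM ?sqr_ge0 ?(ltW (d0 j)).
    have bi2 : 0 < b 0 i ^+ 2 by rewrite exprn_gt0.
    apply: (@le_trans _ _ (4 / 3 * (b 0 i ^+ 2 * (40 / 41)))); first by rewrite exprMn; lra.
    apply: ler_pM => //; last by rewrite ler_wpM2l ?(ltW bi2).
    by apply: mulr_ge0; [exact: ltW|lra].
(* Equal Gram matrices: [g * b] and [u * b'] differ by an orthogonal factor on the right, which
   serves as the [K]-part. *)
have gram : g *m diag_mx b *m (g *m diag_mx b)^T
          = u *m diag_mx b' *m (u *m diag_mx b')^T.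
  rewrite -bW trmx_mul !mulmxA -[X in X *m _]mulmxA -/S SE.
  have -> : u *m diag_mx b' = diag_mx b *m U *m diag_mx (\row_i Num.sqrt (d 0 i)).
    apply/matrixP => i j; rewrite !mul_mx_diag mul_diag_mx !mxE; field.
    by rewrite !nb.
  rewrite !trmx_mul !tr_diag_mx !mulmxA; congr (_ *m _ *m _).
  rewrite -!mulmxA; congr (_ *m (_ *m _)).
  apply/matrixP => i j; rewrite mul_mx_diag !mxE; case: eqP => [->|_].
    by rewrite !mulr1n -expr2 sqr_sqrtr // ltW.
  by rewrite !mulr0n mul0r.
have detb : \det (diag_mx b) = 1 by rewrite det_diag.
have det_u : \det u = 1 by case: ured => u1 u0 _ _ _; exact: det_upper_unitri.
have det_gb : \det (g *m diag_mx b) = 1 by rewrite det_mulmx g1 detb mulr1.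
have b'1 : \prod_i b' 0 i = 1.
  have := congr1 determinant gram; rewrite det_mulmx det_tr det_gb det_mulmx.
  rewrite det_tr det_mulmx det_u !mul1r det_diag => /esym /eqP.
  rewrite -expr2 sqrf_eq1 => /orP[/eqP //|/eqP pN].
  have : 0 < \prod_i b' 0 i by apply: prodr_gt0.
  by rewrite pN; lra.
have det_ub : \det (u *m diag_mx b') = 1.
  by rewrite det_mulmx det_u mul1r det_diag.
have ubU : u *m diag_mx b' \in unitmx by rewrite unitmxE det_ub unitr1.
apply/Siegel_setP => //; exists u, b', (invmx (u *m diag_mx b') *m (g *m diag_mx b)).
split=> //; last by rewrite mulmxA mulmxV // mul1mx.
split; last by rewrite det_mulmx det_inv det_ub det_gb invr1 mulr1.
move: gram ubU; move: (u *m diag_mx b') (g *m diag_mx b) => m h gram mU.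
rewrite trmx_mul mulmxA -(mulmxA _ h) gram.
by rewrite mulmxA mulVmx // mul1mx -trmx_mul mulVmx // trmx1.
Qed.

Lemma Siegel_t_sqr (R : realType) : (2 / Num.sqrt 3 : R) ^+ 2 = 4 / 3.
Proof. by rewrite expr_div_n sqr_sqrtr ?ler0n // -natrX. Qed.

Lemma Siegel_t_ge0 (R : realType) : 0 <= 2 / Num.sqrt 3 :> R.
Proof. by rewrite divr_ge0 ?sqrtr_ge0. Qed.

Lemma Siegel_t_ge (R : realType) (c : R) :
  c ^+ 2 <= 4 / 3 -> c <= 2 / Num.sqrt 3.
Proof.
have [c0|c0] := lerP 0 c.
  by rewrite -Siegel_t_sqr ler_sqr ?nnegrE ?Siegel_t_ge0.
by move=> _; rewrite (le_trans (ltW c0)) ?Siegel_t_ge0.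
Qed.

Lemma Siegel_t_le2 (R : realType) : 2 / Num.sqrt 3 <= 2 :> R.
Proof.
rewrite -ler_sqr ?nnegrE ?Siegel_t_ge0 ?ler0n // Siegel_t_sqr; lra.
Qed.

Lemma leq_card_injective (X : finType) (T : choiceType) (A : {pred X})
    (f : X -> T) (S : set T) :
  finite_set S -> {in A &, injective f} -> (forall x, x \in A -> S (f x)) ->
  (#|A| <= #|` fset_set S|)%N.
Proof.
move=> finS injf fS.
have sub : ([fset f x | x in A] `<=` fset_set S)%fset.
  by apply/fsubsetP => _ /imfsetP[x /= xA ->]; rewrite in_fset_set // inE; exact: fS.
apply: leq_trans (fsubset_leq_card sub).
by rewrite card_in_imfset //= -cardE.
Qed.

(** * The upper bound on the self-meeting set, and two explicit elements *)

Section SelfMeeting.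
Variables (R : realType) (n : nat).
Let t : R := 2 / Num.sqrt 3.
Let I := self_meeting (SLZ R n) (Siegel_set n t (1 / 2)).

Let t1 : 1 <= t. Proof. by apply: Siegel_t_ge; lra. Qed.
Let t0 : 0 < t. Proof. exact: lt_le_trans t1. Qed.

Lemma self_meeting_intro (g : 'M[int]_n) (x : 'M[R]_n) :
  \det g = 1 -> Siegel_set n t (1 / 2) x ->
  Siegel_set n t (1 / 2) (map_mx intr g *m x) -> I (map_mx intr g).
Proof.
move=> g1 xS gxS; split; first by exists g.
by exists (map_mx intr g *m x); split=> //; exists x.
Qed.

Lemma self_meeting_entry (gam : 'M[R]_n) : (2 <= n)%N -> I gam ->
  exists2 g : 'M[int]_n, gam = map_mx intr g &
    forall i j, (`|g i j| <= n ^ (13 * n ^ 2))%N.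
Proof.
move=> n2 [[g g1 <-] [y [[x xS gxy] yS]]]; exists g => // i j.
have [u [b [k [ub _ [kk _] xE]]]] := (Siegel_setP _ t0).1 xS.
have [u' [b' [k' [ub' _ [k'k' _] yE]]]] := (Siegel_setP _ t0).1 yS.
have gU : g \in unitmx by rewrite unitmxE g1 unitr1.
have kap : (k' *m k^T) *m (k' *m k^T)^T = 1%:M.
  by rewrite trmx_mul trmxK mulmxA -(mulmxA _ k^T) orthogonal_trC // mulmx1.
have gub : map_mx intr g *m u *m diag_mx b = u' *m diag_mx b' *m (k' *m k^T).
  rewrite mulmxA -yE -gxy xE !mulmxA -(mulmxA _ k) kk mulmx1 //.
have := intertwined_bound t1 (mulmxV gU) ub ub' kap gub i j.
set N : R := n%:R; set T := t ^+ n => bnd.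
have N2 : 2 <= N by rewrite ler_nat.
have N1 : 1 <= N by lra.
have N0 : 0 <= N by lra.
have T0 : 0 <= T by rewrite exprn_ge0 ?ltW.
(* As [t <= 2 <= n], every factor of the bound is at most a power of [n]. *)
have TN : T <= N ^+ n.
  by apply: lerXn2r; rewrite ?nnegrE ?(ltW t0) // (le_trans (Siegel_t_le2 _)).
have TNm m : T ^+ m <= N ^+ (n * m).
  by rewrite exprM; apply: lerXn2r => //; rewrite ?nnegrE ?exprn_ge0.
have TNm0 m : 0 <= T ^+ m by rewrite exprn_ge0.
have NN m : 0 <= N ^+ m by rewrite exprn_ge0.
rewrite -(ler_nat R) natrX -/N; apply: le_trans bnd _.
(* The exponents add up to [8 n^2 + 8 n + 2], which is at most [13 n^2] for [n >= 2]. *)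
apply: (@le_trans _ _ (N * (N * N ^+ (n * 4) * (N ^+ ((2 + n * 8) * n) * N ^+ n)) * N ^+ n)); last first.
  rewrite -exprS -!exprD -exprS -exprD ler_weXn2l //; nia.
have Gle : (N ^+ 2 * T ^+ 8) ^+ n <= N ^+ ((2 + n * 8) * n).
  rewrite [leRHS]exprM exprD; apply: lerXn2r; rewrite ?nnegrE ?mulr_ge0 //.
  by rewrite ler_wpM2l.
have Gn0 : 0 <= (N ^+ 2 * T ^+ 8) ^+ n by rewrite exprn_ge0 // mulr_ge0.
have jn : 2 ^+ j <= N ^+ n.
  apply: (@le_trans _ _ (N ^+ j)); first by apply: lerXn2r; rewrite ?nnegrE.
  by rewrite ler_weXn2l // ltnW.
apply: ler_pM => //; first by rewrite !mulr_ge0.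
apply: ler_pM => //; first by rewrite !mulr_ge0.
by rewrite ler_pM ?mulr_ge0 // ler_pM.
Qed.

Lemma self_meeting_finite_card : (2 <= n)%N ->
  finite_set I /\ (#|` fset_set I| <= n ^ (15 * n ^ 4))%N.
Proof.
move=> n2; set B := (n ^ (13 * n ^ 2))%N.
(* Entries in [[-B, B]] are shifted by [B] to become ordinals, so [f] parametrizes a set containing
   [I] by a finite matrix type. *)
pose f (M : 'M['I_(2 * B).+1]_n) : 'M[R]_n :=
  map_mx (fun i : 'I_(2 * B).+1 => ((i : nat)%:Z - B%:Z)%:~R) M.
have IK : I `<=` [set` [fset f M | M in {: 'M['I_(2 * B).+1]_n}]%fset].
  move=> gam /(self_meeting_entry n2) [g -> gB] /=.
  apply/imfsetP; exists (\matrix_(i, j) inord (absz (g i j + B%:Z))) => //.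
  apply/matrixP => i j; rewrite !mxE; have := gB i j; rewrite -/B => gijB.
  by rewrite inordK; [congr (_%:~R); lia|lia].
have finI : finite_set I by apply: sub_finite_set IK (finite_fset _).
split=> //; set K := [fset _ | _ in _]%fset in IK.
have IKf : (fset_set I `<=` K)%fset.
  by apply/fsubsetP => x; rewrite in_fset_set // inE => /IK.
apply: leq_trans (fsubset_leq_card IKf) _.
apply: leq_trans (leq_imfset_card _ _ _) _.
rewrite -cardE card_mx card_ord.
have B1 : (1 <= B)%N by rewrite expn_gt0; lia.
(* Indeed [2 B + 1 <= 4 B <= n^2 B]. *)
have le1 : ((2 * B).+1 <= n ^ (13 * n ^ 2 + 2))%N.
  rewrite expnD -/B; nia.
apply: (@leq_trans ((n ^ (13 * n ^ 2 + 2)) ^ (n * n))%N).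
  by rewrite leq_exp2r //; nia.
rewrite -expnM leq_exp2l // mulnn (expnM n 2 2).
have : (4 <= n ^ 2)%N by rewrite -mulnn; nia.
move: (n ^ 2)%N => m m4; rewrite -mulnn; nia.
Qed.

Lemma self_meeting_card_ge2 : (2 <= n)%N -> (2 <= #|` fset_set I|)%N.
Proof.
move=> n2; have [finI _] := self_meeting_finite_card n2.
have i0lt : (0 < n)%N by lia. have i1lt : (1 < n)%N by lia.
pose i0 := Ordinal i0lt; pose i1 := Ordinal i1lt.
pose e (A : comNzRingType) (c : A) : 'M[A]_n := 1%:M + c *: delta_mx i0 i1.
have e_red (c : R) : `|c| <= 1 / 2 -> Siegel_set n t (1 / 2) (e R c).
  move=> c2; apply/Siegel_setP => //.
  exists (e R c), (const_mx 1), 1%:M; split.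
  - split=> [i|i j ji|i j ij|i|i j _].
    + by rewrite !mxE eqxx; case: eqP => [->|_]; rewrite ?mulr0 ?addr0.
    + rewrite !mxE; have -> : (i == j) = false by rewrite -val_eqE /=; lia.
      have -> : (i == i0) && (j == i1) = false by rewrite -!val_eqE /=; lia.
      by rewrite mulr0 addr0.
    + rewrite !mxE; have -> : (i == j) = false by rewrite -val_eqE /=; lia.
      rewrite mulr0n add0r; case: (_ && _); rewrite ?mulr1 ?mulr0 ?normr0 //; lra.
    + by rewrite mxE.
    + by rewrite !mxE mulr1.
  - by rewrite big1 // => i _; rewrite mxE.
  - by split; rewrite ?trmx1 ?mul1mx ?det1.
  - by rewrite diag_const_mx !mulmx1.
have e_mul (c d : R) : e R c *m e R d = e R (c + d).
  rewrite /e mulmxDl !mulmxDr !mul1mx mulmx1 -scalemxAl -scalemxAr.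
  by rewrite mul_delta_mx_0 // !scaler0 addr0 -addrA -scalerDl [d + c]addrC.
have e_det (c : int) : \det (e int c) = 1.
  apply: det_upper_unitri => [i|i j ji].
    by rewrite !mxE eqxx; case: eqP => [->|_]; rewrite ?mulr0 ?addr0.
  rewrite !mxE; have -> : (i == j) = false by rewrite -val_eqE /=; lia.
  have -> : (i == i0) && (j == i1) = false by rewrite -!val_eqE /=; lia.
  by rewrite mulr0 addr0.
have e_map (c : int) : map_mx intr (e int c) = e R c%:~R.
  by rewrite /e map_mxD map_mx1 map_mxZ map_delta_mx.
have e_inj : injective (e R).
  move=> c d /matrixP/(_ i0 i1); rewrite !mxE !eqxx !mulr1; exact: addrI.
rewrite -card_bool; apply: (@leq_card_injective _ _ predT (fun x : bool => e R x%:R)) => //.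
  by move=> [] [] _ _ /e_inj // /eqP; rewrite ?oner_eq0 // eq_sym oner_eq0.
move=> x _; have -> : e R x%:R = map_mx intr (e int x%:R) by rewrite e_map; case: x.
apply: (@self_meeting_intro _ (e R (- (x%:R / 2)))) => //.
  by apply: e_red; case: x; rewrite ?normrN ?mul0r ?normr0 ?ger0_norm //; lra.
rewrite e_map e_mul; apply: e_red.
by case: x => /=; rewrite ?mul0r ?subr0 ?normr0 ?ger0_norm //; lra.
Qed.

End SelfMeeting.

(** * Lower bound from unipotent matrices with a free lower left corner *)

(** With ratio [sg ^+ 2] the product is an exact [n]-th power, so dividing each term by [sg ^+ n.-1]
    normalizes it to 1 without taking an [n]-th root. *)
Lemma prod_geometric (R : comNzRingType) (sg : R) n :
  \prod_(i < n) (sg ^+ 2) ^+ i = (sg ^+ n.-1) ^+ n.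
Proof.
elim: n => [|n IHn]; first by rewrite big_ord0 expr0.
rewrite big_ord_recr IHn /= -!exprM -exprD; congr (_ ^+ _).
by case: n {IHn} => //= n; lia.
Qed.

Lemma third_bounds n k : (3 * k + 3 <= n)%N ->
  [/\ 3 * (n %/ 3) <= n, n <= 3 * (n %/ 3) + 2 & k < n %/ 3]%N.
Proof. by split; lia. Qed.

Section LowerBound.
Variables (R : realType) (n h m : nat).
Let t : R := 2 / Num.sqrt 3.
Let I := self_meeting (SLZ R n) (Siegel_set n t (1 / 2)).

Let corner : {pred 'I_n * 'I_n} :=
  [pred x : 'I_n * 'I_n | (n - h <= x.1)%N && (x.2 < h)%N].

Definition corner_mx (Z : {ffun 'I_n * 'I_n -> 'I_m.+1}) : 'M[int]_n :=
  \matrix_(p, q) ((p == q)%:R + (Z (p, q) : nat)%:Z).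

Let sg : R := Num.sqrt (9 / 8).
Let sg1 : 1 < sg.
Proof. by rewrite -sqrtr1 ltr_sqrt; lra. Qed.
Let sg0 : 0 < sg. Proof. exact: lt_trans sg1. Qed.
Let sg2 : sg ^+ 2 = 9 / 8. Proof. by rewrite sqr_sqrtr //; lra. Qed.

Let b : 'rV[R]_n := \row_i ((9 / 8) ^+ i / sg ^+ n.-1).

(** In the corner [p - q >= h], since [p >= n - h >= 2 h] and [q < h]. Conjugation by [b] therefore
    divides the entry by at least [(9/8)^h], and the hypothesis on [m] is exactly the tolerance of
    [reduced_of_near_diag]. *)
Lemma corner_mx_self_meeting (Z : {ffun 'I_n * 'I_n -> 'I_m.+1}) :
  (0 < n)%N -> (3 * h <= n)%N ->
  m%:R * (3 * (n%:R + 40)) <= (9 / 8) ^+ h :> R ->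
  Z \in pffun_on ord0 corner predT -> I (map_mx intr (corner_mx Z)).
Proof.
move=> n0 hn hm Zcorner.
have Z0 (p q : 'I_n) : ~~ ((n - h <= p)%N && (q < h)%N) -> Z (p, q) = ord0.
  move=> npq; apply/eqP; apply: contraNT npq => Zpq.
  by have /pffun_onP[/supportP Zsup _] := Zcorner; apply: contraNT Zpq => npq; apply/eqP/Zsup.
have s1 : 1 < 9 / 8 :> R by lra.
have s0 : 0 < 9 / 8 :> R by lra.
have b0 i : 0 < b 0 i by rewrite mxE divr_gt0 ?exprn_gt0.
have b1 : \prod_i b 0 i = 1.
  under eq_bigr do rewrite mxE -sg2.
  rewrite prodf_div prod_geometric prodr_const card_ord divff //.
  by rewrite !expf_neq0 // gt_eqF.
have bmono (i j : 'I_n) : (i <= j)%N -> b 0 i <= b 0 j.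
  move=> ij; rewrite !mxE ler_wpM2r ?invr_ge0 ?exprn_ge0 ?(ltW sg0) //.
  by rewrite ler_weXn2l // ltW.
have bstep (i j : 'I_n) : nat_of_ord j = i.+1 -> b 0 j <= 9 / 8 * b 0 i.
  by move=> ji; rewrite !mxE ji exprS mulrA.
have gdet : \det (corner_mx Z) = 1.
  rewrite det_trig.
    rewrite big1 // => i _; rewrite mxE eqxx Z0 //.
    by have := ltn_ord i; lia.
  apply/is_trig_mxP => i j ij; rewrite mxE Z0; last by lia.
  by rewrite -val_eqE /= ltn_eqF.
have c0 : 0 < 3 * (n%:R + 40) :> R by have : 0 <= n%:R :> R := ler0n _ _; lra.
apply: (@self_meeting_intro _ _ _ (diag_mx b)) => //.
  apply/Siegel_setP; first by apply: lt_le_trans (Siegel_t_ge _); [exact: s0|lra].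
  exists 1%:M, b, 1%:M; split => //; last by rewrite mul1mx mulmx1.
    split => // [i|i j ji|i j ij|i j ji].
    - by rewrite mxE eqxx.
    - by rewrite mxE -val_eqE /= gtn_eqF.
    - by rewrite mxE -val_eqE /= ltn_eqF // normr0; lra.
    - apply: le_trans (bstep _ _ ji) _; rewrite ler_wpM2r ?(ltW (b0 i)) //.
      by apply: Siegel_t_ge; lra.
  by split; rewrite ?trmx1 ?mul1mx ?det1.
apply: (reduced_of_near_diag (Siegel_t_ge0 R)) => //.
- by rewrite Siegel_t_sqr.
- have -> : \det (map_mx intr (corner_mx Z)) = (\det (corner_mx Z))%:~R :> R.
    by rewrite det_map_mx.
  by rewrite gdet.
move=> p q; rewrite !mxE.
case: (boolP ((n - h <= p)%N && (q < h)%N)) => [/andP[np qh]|pq]; last first.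
  rewrite Z0 // addr0; case: eqP => [->|_]; last first.
    by rewrite !mul0r subrr normr0 invr_ge0 ltW.
  by rewrite mul1r divff ?subrr ?normr0 ?invr_ge0 ?(ltW c0) // mulf_neq0 ?invr_eq0 ?expf_neq0 // gt_eqF.
have -> : (p == q) = false by rewrite -val_eqE /=; apply: gtn_eqF; lia.
rewrite add0r subr0; set z : R := (_%:~R).
have zm : 0 <= z <= m%:R.
  by rewrite /z -pmulrn ler0n ler_nat -ltnS ltn_ord.
have -> : z * ((9 / 8) ^+ q / sg ^+ n.-1) / ((9 / 8) ^+ p / sg ^+ n.-1)
    = z / (9 / 8) ^+ (p - q).
  have -> : nat_of_ord p = (q + (p - q))%N by lia.
  rewrite [(q + _ - q)%N]addKn exprD; field.
  by rewrite !expf_neq0 // gt_eqF.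
case/andP: zm => z0 zm; rewrite ger0_norm ?divr_ge0 ?exprn_ge0 ?(ltW s0) //.
rewrite ler_pdivrMr ?exprn_gt0 // mulrC ler_pdivlMr //.
apply: (@le_trans _ _ (m%:R * (3 * (n%:R + 40)))); first by rewrite ler_wpM2r // ltW.
apply: le_trans hm _; rewrite ler_weXn2l // ?ltW //; lia.
Qed.

Lemma corner_mx_inj : injective corner_mx.
Proof.
move=> Z Z' /matrixP eqZ; apply/ffunP => -[p q]; apply/val_inj.
by have := eqZ p q; rewrite !mxE => /addrI [].
Qed.

Lemma self_meeting_card_ge : (2 <= n)%N -> (3 * h <= n)%N ->
  m%:R * (3 * (n%:R + 40)) <= (9 / 8) ^+ h :> R ->
  (m.+1 ^ (h * h) <= #|` fset_set I|)%N.
Proof.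
move=> n2 hn hm; have [finI _] := self_meeting_finite_card R n2.
have -> : (m.+1 ^ (h * h) = #|pffun_on (ord0 : 'I_m.+1) corner predT|)%N.
  rewrite card_pffun_on (eq_card (B := 'I_m.+1)) // card_ord; congr (_ ^ _)%N.
  have card_lt k : (k <= n)%N -> #|[pred q : 'I_n | (q < k)%N]| = k.
    move=> kn; rewrite -sum1_card.
    by rewrite (big_ord_narrow kn (F := fun=> 1%N)) sum1_card card_ord.
  rewrite (eq_card (B := [predX [pred p : 'I_n | (n - h <= p)%N] & [pred q : 'I_n | (q < h)%N]])) //.
  rewrite cardX card_lt; last by lia.
  congr (_ * _)%N; have := cardC [pred p : 'I_n | (p < n - h)%N].
  rewrite card_lt ?leq_subr // card_ord (eq_card (B := [pred p : 'I_n | (n - h <= p)%N])).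
    by lia.
  by move=> p; rewrite !inE -leqNgt.
apply: (leq_card_injective finI (f := fun Z => map_mx intr (corner_mx Z) : 'M[R]_n)).
  move=> Z Z' _ _ eqZ; apply: corner_mx_inj; apply/matrixP => p q.
  by have /matrixP/(_ p q) := eqZ; rewrite [LHS]mxE [RHS]mxE => /intr_inj.
by move=> Z; apply: corner_mx_self_meeting => //; lia.
Qed.
End LowerBound.

(** * Choice of the constants *)

Theorem corollary6p2 (R : realType) :
  exists c1 c2 : R, [/\ 0 < c1, 0 < c2 &
    forall n : nat, (2 <= n)%N ->
      let I := self_meeting (SLZ R n) (Siegel_set n (2 / Num.sqrt 3) (1 / 2)) in
      [/\ finite_set I,
          expR (c1 * n%:R ^+ 3) <= (#|` fset_set I|)%:R &
          (#|` fset_set I|)%:R <= expR (c2 * n%:R ^+ 4 * ln n%:R)]].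
Proof.
pose sg : R := Num.sqrt (9 / 8); pose L := ln sg.
have sg1 : 1 < sg by rewrite -sqrtr1 ltr_sqrt; lra.
have sg2 : sg ^+ 2 = 9 / 8 by rewrite sqr_sqrtr //; lra.
have L0 : 0 < L by rewrite ln_gt0.
have sgE : expR L = sg by rewrite lnK // posrE; lra.
(* The number 540 is [4 * 135]: for [n <= 3 h + 2] and [h >= 1] one has
   [3 (n + 40) <= 9 h + 126 <= 135 h], to be compared with [h^2 L^2 / 4]. *)
have [h0 h0L] : exists h0 : nat, 540 / L ^+ 2 < h0%:R.
  exists (Num.bound (540 / L ^+ 2)); apply: archi_boundP.
  by rewrite divr_ge0 ?exprn_ge0 ?ler0n // ltW.
pose n0 : R := (3 * h0 + 3)%:R.
have n00 : 0 < n0 by rewrite ltr0n; lia.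
(* The first term makes the bound at most 2 for [n < n0]. The second serves large [n], where
   [n <= 5 h] gives [n^3 <= 125 h^3]. *)
pose c1 := Num.min (ln 2 / n0 ^+ 3) (L / 125).
have c1a : c1 <= ln 2 / n0 ^+ 3 by rewrite ge_min lexx.
have c1b : c1 <= L / 125 by rewrite ge_min lexx orbT.
have c10 : 0 < c1.
  by rewrite lt_min !divr_gt0 ?exprn_gt0 ?ln_gt0 //; lra.
exists c1, 15; split => // n n2 I.
have [finI cardI] := self_meeting_finite_card R n2.
have nE : expR (ln n%:R) = n%:R :> R by rewrite lnK // posrE ltr0n; lia.
split => //; last first.
  have -> : 15 * n%:R ^+ 4 * ln n%:R = (15 * n ^ 4)%:R * ln n%:R :> R.
    by rewrite natrM natrX.
  by rewrite expRM_natl nE -natrX ler_nat.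
have [nle|nlt] := ltnP n (3 * h0 + 3).
  apply: (@le_trans _ _ 2); last by rewrite ler_nat self_meeting_card_ge2.
  rewrite -[leRHS](@lnK R) ?posrE // ler_expR.
  apply: (@le_trans _ _ (ln 2 / n0 ^+ 3 * n0 ^+ 3)); last by rewrite divfK // expf_neq0 // gt_eqF.
  apply: ler_pM => //; first exact: ltW.
  by apply: lerXn2r; rewrite ?nnegrE ?ler0n // ler_nat ltnW.
pose h := (n %/ 3)%N; pose D : R := 3 * (n%:R + 40).
have [hn nh hh0] := third_bounds nlt.
have nR : n%:R <= 3 * h%:R + 2 :> R by rewrite -natrM -natrD ler_nat.
have h1 : 1 <= h%:R :> R by rewrite ler1n (leq_ltn_trans _ hh0).
have hL : 540 <= h%:R * L ^+ 2.
  rewrite -ler_pdivrMr ?exprn_gt0 //; apply: le_trans (ltW h0L) _.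
  by rewrite ler_nat ltnW.
(* Squaring [1 + x <= exp x] at [x = h L / 2] gives a lower bound for [sg ^+ h] quadratic in [h],
   which beats the linear [D]. *)
have sgh : D <= sg ^+ h.
  have : 1 + h%:R * (L / 2) <= expR (h%:R * (L / 2)) by exact: expR_ge1Dx.
  have -> : sg ^+ h = expR (h%:R * (L / 2)) ^+ 2.
    by rewrite -expRM_natl -sgE -expRM_natl; congr expR; field.
  move=> le1; apply: (@le_trans _ _ ((1 + h%:R * (L / 2)) ^+ 2)); last first.
    apply: lerXn2r => //; rewrite nnegrE ?expR_ge0 //.
    by rewrite addr_ge0 // mulr_ge0 // divr_ge0 // ltW.
  have hL0 : 0 <= h%:R * L by rewrite mulr_ge0 // ltW.
  have : 540 * h%:R <= h%:R * L ^+ 2 * h%:R by rewrite ler_wpM2r.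
  have -> : (1 + h%:R * (L / 2)) ^+ 2 = 1 + h%:R * L + h%:R * L ^+ 2 * h%:R / 4.
    by field.
  by rewrite /D; lra.
have D0 : 0 < D by rewrite /D; have : 0 <= n%:R :> R := ler0n _ _; lra.
(* Since [(9/8)^h] is the square of [sg ^+ h], one factor [sg ^+ h] absorbs [D] and the other bounds
   [m.+1] from below. Then [m.+1 ^ (h * h)] is at least [exp (L h^3)]. *)
pose m := Num.truncn ((9 / 8) ^+ h / D : R).
have mle : m%:R * D <= (9 / 8) ^+ h :> R.
  rewrite -ler_pdivlMr // truncn_le divr_ge0 ?exprn_ge0 ?(ltW D0) //; lra.
have mge : sg ^+ h <= m.+1%:R.
  apply: (@le_trans _ _ ((9 / 8) ^+ h / D)); last by apply/ltW/truncnS_gt.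
  rewrite ler_pdivlMr // -sg2 exprAC expr2 ler_wpM2l // exprn_ge0 //; lra.
have := self_meeting_card_ge n2 hn mle.
rewrite -(ler_nat R) natrX; apply: le_trans.
apply: (@le_trans _ _ ((sg ^+ h) ^+ (h * h))); last first.
  by apply: lerXn2r; rewrite ?nnegrE ?ler0n // exprn_ge0 //; lra.
rewrite -exprM -sgE -expRM_natl ler_expR.
have n5 : n%:R ^+ 3 <= (5 * h%:R) ^+ 3 :> R.
  by apply: lerXn2r; rewrite ?nnegrE ?ler0n //; lra.
apply: (@le_trans _ _ (L / 125 * (5 * h%:R) ^+ 3)).
  by apply: ler_pM => //; exact: ltW.
rewrite !natrM le_eqVlt; apply/orP; left; apply/eqP; by field.
Qed.
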